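(* For all integers $k \geq 1$ and $n\ge 1$, $$\Omega_{2k}(n) = \sum_{r=1}^k d_{k,r} \big(S_1(n)\big)^r, \qquad\text{where}\qquad d_{k,r} = \sum_{m=r}^k \frac{2^r}{(2m)!}\, R(k,m)\, Ps_m^{(r)} \quad (1\le r\le k).$$
   Context: For integers $k,n\ge 1$, $\Omega_k(n) = \sum_{i=1}^n (-1)^{n-i} i^k = n^k - (n-1)^k + \cdots + (-1)^{n-1} 1^k$, and $S_1(n) = 1+2+\cdots+n$. For integers $0 \le m \le k$, the numbers $R(k,m)$ (OEIS A304330) are defined by $$R(k,m) = \sum_{j=0}^m (-1)^j \binom{2m}{j} (m-j)^{2k},$$ with the convention $0^0=1$. The (signed) Legendre-Stirling numbers of the first kind $Ps_m^{(r)}$, $1\le r\le m$ (OEIS A129467), are defined by the polynomial identity $$\prod_{j=0}^{m-1} \big(x - j(j+1)\big) = \sum_{r=1}^m Ps_m^{(r)} x^r .$$ *)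

(* Defs.v *)
From mathcomp Require Import all_boot all_order all_algebra.

Set Implicit Arguments.
Unset Strict Implicit.
Unset Printing Implicit Defensive.

Import GRing.Theory.
Local Open Scope ring_scope.

(* The exponent n - i is a truncated subtraction, but i <= n throughout. *)
Definition Omega (k n : nat) : int :=
  \sum_(1 <= i < n.+1) (-1) ^+ (n - i) * i%:Z ^+ k.

Definition S1 (n : nat) : nat := (\sum_(1 <= i < n.+1) i)%N.

(* OEIS A304330; 0 ^+ 0 = 1 holds in MathComp. *)
Definition R304330 (k m : nat) : int :=
  \sum_(0 <= j < m.+1)
    (-1) ^+ j * ('C(2 * m, j))%:Z * (m%:Z - j%:Z) ^+ (2 * k).

Definition PsPoly (m : nat) : {poly int} :=
  \prod_(0 <= j < m) ('X - (j%:Z * (j%:Z + 1))%:P).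

(* Signed Legendre-Stirling numbers of the first kind, OEIS A129467; the
   defining polynomial identity is PsPolyE below. *)
Definition Ps (m r : nat) : int := (PsPoly m)`_r.

Lemma PsPolyE (m : nat) : (1 <= m)%N ->
  \prod_(0 <= j < m) ('X - (j%:Z * (j%:Z + 1))%:P)
    = \sum_(1 <= r < m.+1) Ps m r *: 'X^r.
Proof.
move=> m_gt0; rewrite -/(PsPoly m).
have szP : size (PsPoly m) = m.+1.
  by rewrite /PsPoly size_prod_XsubC size_iota subn0.
have P0 : (PsPoly m)`_0 = 0.
  by rewrite /PsPoly big_ltn // mul0r subr0 coefXM.
rewrite -[LHS]coefK poly_def szP big_ord_recl P0 scale0r add0r.
by rewrite big_add1 big_mkord.
Qed.

Definition dcoef (k r : nat) : rat :=
  \sum_(r <= m < k.+1)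
    2 ^+ r / ((2 * m)`!)%:R * (R304330 k m)%:~R * (Ps m r)%:~R.

(* Main.v *)
Require Import Defs.
From mathcomp Require Import all_boot all_order all_algebra.
From mathcomp Require Import ring zify.

(** By definition Omega (2k) satisfies Omega (2k) n + Omega (2k) (n - 1) = n^(2k)
    and vanishes at n = 0, so it suffices that the right-hand side does too.

    Since 2 S1(n) = n(n+1), substituting y = n(n+1) in the polynomial that
    defines the Ps m r turns the right-hand side, after exchanging the two sums,
    into
      F(n) = sum_(m = 1..k) R(k,m) / (2m)! * P_m(n),
      P_m(x) = prod_(j < m) (x(x+1) - j(j+1)) = prod_(j < m) (x-j)(x+j+1)
    (PsFact_S1). Each P_m with m > 0 vanishes at 0. In P_m(x) and P_m(x-1) all
    linear factors but one are the same, and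
      P_m(x) + P_m(x-1) = 2 prod_(j < m) (x^2 - j^2)
    (PsFact_add_pred). What is left is the expansion of an even power in central
    factorials,
      x^(2k) = 2 sum_(m = 1..k) R(k,m) / (2m)! * prod_(j < m) (x^2 - j^2)
    (expr_centralFact), which says that 2 R(k,m) / (2m)! is the central factorial
    number T(2k,2m). It follows by induction on k from the recurrence
      R(k+1,m+1) = (m+1)^2 R(k,m+1) + (2m+2)(2m+1) R(k,m)
    (R304330_rec) and from R(k,m) = 0 for m > k > 0 (R304330_small). *)

Set Implicit Arguments.
Unset Strict Implicit.
Unset Printing Implicit Defensive.

Import GRing.Theory Num.Theory.

Local Open Scope ring_scope.

Lemma bin_double_absorb (m j : nat) : (j <= 2 * m)%N ->
  (j.+1 * (2 * m.+1 - j.+1) * 'C(2 * m.+1, j.+1) =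
   (2 * m).+2 * (2 * m).+1 * 'C(2 * m, j))%N.
Proof.
move=> le_j; have -> : (2 * m.+1 = (2 * m).+2)%N by lia.
have diag := mul_bin_diag (2 * m).+2 j.
have down := mul_bin_down (2 * m).+1 j.
rewrite /= in diag down.
by rewrite subSS mulnAC -diag -mulnA [('C(_, j) * _)%N]mulnC -down mulnA.
Qed.

(** The difference R(k+1,m) - m^2 R(k,m) carries the factor
    (m-j)^2 - m^2 = - j(2m-j) in its j-th term; this removes the term j = 0, is
    absorbed by the binomial coefficient, and leaves the sum R(k,m-1) after a
    shift of j. The convention 0^0 = 1 makes it hold for k = 0 too. *)
Lemma R304330_rec (k m : nat) :
  R304330 k.+1 m.+1 = (m.+1%:Z) ^+ 2 * R304330 k m.+1
    + ((2 * m).+2 * (2 * m).+1)%:Z * R304330 k m.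
Proof.
apply/eqP; rewrite -subr_eq0 opprD addrA subr_eq0; apply/eqP.
rewrite /R304330 !mulr_sumr -sumrB big_nat_recl //.
rewrite bin0 expr0 subr0 !mul1r mulnS exprD subrr add0r.
apply: eq_big_nat => j /andP[_ lt_jm].
have le_j : (j <= 2 * m)%N by lia.
have /(congr1 Posz) := bin_double_absorb le_j.
rewrite !PoszM -subzn; last by lia.
have -> : m%:Z - j%:Z = m.+1%:Z - j.+1%:Z by lia.
rewrite exprD exprS; have -> : (2 * m.+1)%:Z = 2 * m.+1%:Z by lia.
set M := m.+1%:Z; set J := j.+1%:Z; set t := (M - J) ^+ (2 * k) => E.
(* (M - J)^2 - M^2 = - J (2M - J), and the sign (-1)^(j+1) cancels the minus *)
transitivity ((-1) ^+ j * t * (J * (2 * M - J) * ('C((2 * m.+1), j.+1))%:Z)).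
  by ring.
by rewrite E; ring.
Qed.

Lemma alternating_bin_partial_sum (n p : nat) :
  \sum_(0 <= j < p.+1) (-1) ^+ j * ('C(n.+1, j))%:Z = (-1) ^+ p * ('C(n, p))%:Z.
Proof.
elim: p => [|p IHp]; first by rewrite big_nat1 !bin0.
by rewrite big_nat_recr //= IHp binS PoszD exprS; ring.
Qed.

(** For k = 0 the defining sum runs over an alternating row of Pascal's triangle
    up to its middle and does not vanish; this is why the vanishing below starts
    at k = 1. *)
Lemma R304330_0S (m : nat) :
  R304330 0 m.+1 = (-1) ^+ m.+1 * ('C((2 * m).+1, m.+1))%:Z.
Proof.
rewrite -alternating_bin_partial_sum /R304330.
apply: eq_big_nat => j _; rewrite muln0 expr0 mulr1.
by have -> : (2 * m.+1 = (2 * m).+2)%N by lia.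
Qed.

Lemma R304330_S0 (k : nat) : R304330 k.+1 0 = 0.
Proof. by rewrite /R304330 big_nat1 subrr mulnS exprD expr0n mul0r mulr0. Qed.

Lemma R304330_11 : R304330 1 1 = 1.
Proof. by rewrite /R304330 big_nat_recr //= big_nat1 !(bin0, bin1). Qed.

(** The recurrence propagates the vanishing from k to k+1. At the start
    (k = 1 in R(k,m)) its two terms, known from [R304330_0S], cancel each other, because
    m^2 C(2m-1,m) = 2m (2m-1) C(2m-3,m-1). *)
Lemma R304330_small (k m : nat) : (k < m)%N -> R304330 k.+1 m.+1 = 0.
Proof.
elim: k m => [|k IHk] [|m] // lt_km; rewrite R304330_rec; last first.
  by rewrite !IHk ?mulr0 //; lia.
rewrite !R304330_0S.
have /= diag := mul_bin_diag (2 * m.+1).+1 m.+1.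
have down : ((2 * m.+1) * 'C((2 * m).+1, m.+1) = m.+1 * 'C(2 * m.+1, m.+1))%N.
  have := mul_bin_down (2 * m.+1) m.+1.
  have -> : (2 * m.+1 - m.+1 = m.+1)%N by lia.
  by have -> : (2 * m.+1).-1 = (2 * m).+1 by lia.
have half : 'C(2 * m.+1, m.+1) = (2 * 'C((2 * m).+1, m.+1))%N.
  by apply/eqP; rewrite -(eqn_pmul2l (ltn0Sn m)) -down mulnA [(m.+1 * 2)%N]mulnC.
rewrite half in diag.
have /(congr1 Posz) := diag; rewrite !PoszM => E.
rewrite [(-1) ^+ m.+2]exprS [_ ^+ 2 * _]mulrC mulrAC.
have -> : (2 * m.+1).+2%:Z = 2 * m.+2%:Z by lia.
transitivity ((-1) ^+ m.+1 * m.+2%:Z *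
  ((2 * m.+1).+1%:Z * (2%:Z * ('C((2 * m).+1, m.+1))%:Z)
     - m.+2%:Z * ('C((2 * m.+1).+1, m.+2))%:Z)).
  by ring.
by rewrite E subrr mulr0.
Qed.

(** Half the central factorial number T(2k,2m), for k > 0. *)
Definition halfCFN (k m : nat) : rat := (R304330 k m)%:~R / ((2 * m)`!)%:R.

Lemma halfCFN_rec (k m : nat) :
  halfCFN k.+1 m.+1 = m.+1%:R ^+ 2 * halfCFN k m.+1 + halfCFN k m.
Proof.
rewrite /halfCFN R304330_rec rmorphD !rmorphM /= mulrDl mulrA; congr (_ + _).
have -> : (2 * m.+1 = (2 * m).+2)%N by lia.
rewrite !factS !natrM.
have f_neq0 : ((2 * m)`!)%:R != 0 :> rat by rewrite pnatr_eq0 -lt0n fact_gt0.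
have neq0 i : i.+1%:R != 0 :> rat by rewrite pnatr_eq0.
rewrite -pmulrn natrM; move: (neq0 (2 * m)%N) (neq0 (2 * m).+1) f_neq0.
move: (_.+1%:R) (_.+2%:R) (_`!%:R) => a b c a0 b0 c0.
by field; rewrite a0 b0 c0.
Qed.

Definition centralFact (x : rat) (m : nat) : rat :=
  \prod_(0 <= j < m) (x ^+ 2 - j%:R ^+ 2).

(** Multiplying by x^2 = m^2 + (x^2 - m^2) maps the m-th central factorial to
    m^2 times itself plus the next one, which is the recurrence of the
    coefficients. The sum may stop at m = k since the coefficient with m = k+1
    is zero, and may start at m = 1 since that with m = 0 is. *)
Lemma expr_centralFact (x : rat) (k : nat) :
  x ^+ (2 * k.+1) =
    2 * \sum_(1 <= m < k.+2) halfCFN k.+1 m * centralFact x m.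
Proof.
elim: k => [|k IHk].
  rewrite big_nat1 /halfCFN R304330_11 /centralFact big_nat1.
  by rewrite muln1 !factS fact0; field.
rewrite mulnS exprD {}IHk mulrCA; congr (2 * _); rewrite mulr_sumr.
pose f m := halfCFN k.+1 m * centralFact x m.+1.
have step m : x ^+ 2 * (halfCFN k.+1 m * centralFact x m)
    = m%:R ^+ 2 * halfCFN k.+1 m * centralFact x m + f m.
  by rewrite /f /centralFact big_nat_recr //=; ring.
under eq_bigr => m _ do rewrite step.
rewrite big_split /= [RHS]big_add1 /=.
under [RHS]eq_bigr => m _ do rewrite halfCFN_rec mulrDl.
rewrite big_split /=; congr (_ + _).
  rewrite [RHS]big_nat_recr //= big_add1 /=.
  by rewrite /halfCFN R304330_small // !(mul0r, mulr0) addr0.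
have h0 : halfCFN k.+1 0 = 0 by rewrite /halfCFN R304330_S0 mul0r.
by rewrite [RHS]big_ltn // h0 mul0r add0r.
Qed.

(** The product (x-m+1) ... (x+m) of 2m consecutive terms, written in x(x+1) as in
    the definition of the Legendre-Stirling numbers. *)
Definition PsFact (x : rat) (m : nat) : rat :=
  \prod_(0 <= j < m) (x * (x + 1) - j%:R * (j%:R + 1)).

(** For m > 0, [centralFact x m] is x times the product over x-m+1, ..., x+m-1,
    and [PsFact x m] has the one further factor x+m. The factor x on the left
    makes the identity hold for m = 0 too. *)
Lemma PsFact_centralFact (x : rat) (m : nat) :
  x * PsFact x m = (x + m%:R) * centralFact x m.
Proof.
elim: m => [|m IHm]; first by rewrite /PsFact /centralFact !big_nil; ring.
rewrite /PsFact /centralFact !big_nat_recr //= mulrA IHm -natr1.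
by rewrite /centralFact; ring.
Qed.

(** Here the extra factor, x-m, is at the lower end. *)
Lemma PsFact_pred_centralFact (x : rat) (m : nat) :
  x * PsFact (x - 1) m = (x - m%:R) * centralFact x m.
Proof.
elim: m => [|m IHm]; first by rewrite /PsFact /centralFact !big_nil; ring.
rewrite /PsFact /centralFact !big_nat_recr //= mulrA IHm -natr1.
by rewrite /centralFact; ring.
Qed.

Lemma PsFact_add_pred (x : rat) (m : nat) : x != 0 ->
  PsFact x m + PsFact (x - 1) m = 2 * centralFact x m.
Proof.
move=> x_neq0; apply: (mulfI x_neq0).
by rewrite mulrDr PsFact_centralFact PsFact_pred_centralFact; ring.
Qed.

Lemma PsFact0 (m : nat) : PsFact 0 m.+1 = 0.
Proof. by rewrite /PsFact big_ltn //= subrr mul0r. Qed.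

Lemma OmegaS (k n : nat) : Omega k n.+1 = n.+1%:Z ^+ k - Omega k n.
Proof.
rewrite /Omega big_nat_recr //= subnn expr0 mul1r addrC; congr (_ + _).
rewrite -sumrN; apply: eq_big_nat => i /andP[_ lt_in].
by rewrite subSn // exprS; ring.
Qed.

(** Both sides vanish at n = 0, and for both the values at n and n+1 add up to
    (n+1)^(2k+2). *)
Lemma Omega_PsFact (k n : nat) :
  (Omega (2 * k.+1) n)%:~R
    = \sum_(1 <= m < k.+2) halfCFN k.+1 m * PsFact n%:R m.
Proof.
elim: n => [|n IHn].
  rewrite /Omega big_geq // big_add1 big1 // => m _.
  by rewrite PsFact0 mulr0.
rewrite OmegaS rmorphB rmorphXn /= {}IHn -pmulrn expr_centralFact.
apply/eqP; rewrite subr_eq -big_split mulr_sumr /=; apply/eqP.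
apply: eq_bigr => m _; rewrite -mulrDr mulrCA.
have -> : n%:R = n.+1%:R - 1 :> rat by rewrite -natr1 addrK.
by rewrite PsFact_add_pred ?pnatr_eq0.
Qed.

Lemma S1_double (n : nat) : 2 * (S1 n)%:R = n%:R * (n%:R + 1) :> rat.
Proof.
elim: n => [|n IHn]; first by rewrite /S1 big_geq // mulr0 mul0r.
by rewrite /S1 big_nat_recr //= natrD mulrDr -/(S1 n) IHn -natr1; ring.
Qed.

Lemma prod_PsPoly (y : rat) (m : nat) : (1 <= m)%N ->
  \prod_(0 <= j < m) (y - j%:R * (j%:R + 1))
    = \sum_(1 <= r < m.+1) (Ps m r)%:~R * y ^+ r.
Proof.
move=> /PsPolyE /(congr1 (fun p => (map_poly intr p).[y])) /=.
rewrite rmorph_prod rmorph_sum horner_prod horner_sum /= => E.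
transitivity (\prod_(0 <= j < m)
    (map_poly intr ('X - (j%:Z * (j%:Z + 1))%:P)).[y]).
  apply: eq_bigr => j _.
  by rewrite rmorphB /= map_polyX map_polyC /= !hornerE rmorphM rmorphD.
rewrite {}E; apply: eq_bigr => r _.
by rewrite map_polyZ map_polyXn !hornerE.
Qed.

Lemma PsFact_S1 (n m : nat) : (1 <= m)%N ->
  PsFact n%:R m = \sum_(1 <= r < m.+1) 2 ^+ r * (Ps m r)%:~R * (S1 n)%:R ^+ r.
Proof.
move=> m_gt0; rewrite /PsFact -S1_double prod_PsPoly //.
by apply: eq_bigr => r _; rewrite exprMn; ring.
Qed.

Theorem mainTheorem6 (k n : nat) (hk : (1 <= k)%N) (hn : (1 <= n)%N) :
  (Omega (2 * k) n)%:~R = \sum_(1 <= r < k.+1) dcoef k r * ((S1 n)%:R : rat) ^+ r.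
Proof.
case: k hk => // k _; rewrite Omega_PsFact.
pose t m r : rat :=
  2 ^+ r / ((2 * m)`!)%:R * (R304330 k.+1 m)%:~R * (Ps m r)%:~R
  * (S1 n)%:R ^+ r.
transitivity (\sum_(1 <= m < k.+2) \sum_(1 <= r < k.+2 | (r <= m)%N) t m r).
  apply: eq_big_nat => m /andP[m_gt0 lt_mk].
  rewrite PsFact_S1 // mulr_sumr (big_nat_widen _ _ k.+2) //=.
  by apply: eq_bigr => r _; rewrite /t /halfCFN; ring.
rewrite (exchange_big_dep_nat predT) //=.
apply: eq_big_nat => r /andP[r_gt0 _]; rewrite /dcoef mulr_suml.
by rewrite [RHS](big_nat_widenl _ 1).
Qed.
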